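(* Suppose that $u:A\rightarrow B$ and $v:B\rightarrow C$ are ring morphisms. (i) If $u$ and $v$ are PSI-morphisms, then so is $vu$. (ii) If $vu$ is a PSI-morphism, then so is $v$.
   Context: All rings are commutative and unitary, and ring morphisms are unitary. For a ring morphism $u:A\to B$, a proper ideal $I$ of $B$ is called $A$-prime if $u(a)b\in I$ with $a\in A$ and $b\in B$ implies that $u(a)\in I$ or $b\in I$. The morphism $u$ is a PSI-morphism if every $A$-prime ideal of $B$ is a prime ideal of $B$. *)

(* Defs.v *)
From HB Require Import structures.
From mathcomp Require Import all_boot all_algebra.
From mathcomp Require Import boolp classical_sets.

Set Implicit Arguments.
Unset Strict Implicit.
Unset Printing Implicit Defensive.

Import GRing.Theory.
Local Open Scope classical_set_scope.
Local Open Scope ring_scope.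

(* Rings are comPzRingType, so that the zero ring is allowed.  The ideals of
   ring_quotient need a nonzero ring, hence the definitions below;
   is_proper_idealP relates the two when 1 != 0. *)

Definition is_ideal (R : comPzRingType) (I : set R) : Prop :=
  [/\ I 0,
      forall x y, I x -> I y -> I (x + y) &
      forall a x, I x -> I (a * x)].

Definition is_proper_ideal (R : comPzRingType) (I : set R) : Prop :=
  is_ideal I /\ I <> setT.

Definition is_prime_ideal (R : comPzRingType) (I : set R) : Prop :=
  is_proper_ideal I /\ forall x y, I (x * y) -> I x \/ I y.

(* "A-prime" ideals of B, for B an A-algebra via u. *)
Definition base_prime_ideal (A B : comPzRingType)
    (u : {rmorphism A -> B}) (I : set B) : Prop :=
  is_proper_ideal I /\ forall a b, I (u a * b) -> I (u a) \/ I b.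

Definition PSI_morphism (A B : comPzRingType) (u : {rmorphism A -> B}) : Prop :=
  forall I : set B, base_prime_ideal u I -> is_prime_ideal I.

Lemma is_proper_idealP (R : comNzRingType) (I : set R) :
  is_proper_ideal I <-> idealr_closed (mem I).
Proof.
split=> [[[I0 ID IM] In1]|[I0 I1 Ilin]].
  split; first by apply/mem_set.
    apply/negP => /set_mem I1; apply: In1; apply/seteqP; split=> // x _.
    by rewrite -[x]mulr1; apply: IM.
  by move=> a x y /set_mem Ix /set_mem Iy; apply/mem_set/ID => //; apply: IM.
have lin a x y : I x -> I y -> I (a * x + y).
  by move=> Ix Iy; apply/set_mem/Ilin; apply/mem_set.
have {}I0 : I 0 by apply/set_mem.
split; last by move=> IT; move/negP: I1; apply; apply/mem_set; rewrite IT.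
split=> // [x y Ix Iy|a x Ix]; first by rewrite -[x]mul1r; apply: lin.
by rewrite -[a * x]addr0; apply: lin.
Qed.

(* Main.v *)
Require Import Defs.
From HB Require Import structures.
From mathcomp Require Import all_boot all_algebra.
From mathcomp Require Import boolp classical_sets.

Set Implicit Arguments.
Unset Strict Implicit.
Unset Printing Implicit Defensive.

Import GRing.Theory.
Local Open Scope classical_set_scope.
Local Open Scope ring_scope.

(** For (ii), a [B]-prime ideal of [C] is [A]-prime, because the condition on
    the scalars coming from [A] is a special case of the one on the scalars
    coming from [B].

    For (i), the [A]-prime ideals of [B] that contract to a prime [p] of [A]
    correspond to the proper ideals of the fibre ring [k(p) (x)_A B]. When [u]
    is a PSI-morphism these are all prime, so a nonzero fibre ring is a field:
    it is a domain in which every [b] lies in the ideal generated by its square,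
    and so every nonzero [b] is a unit. Hence two comparable [A]-prime ideals of
    [B] with the same contraction to [A] are equal ([base_prime_incomparable]).
    Given an [A]-prime ideal [I] of [C] and [c] outside [I], both [v^-1(I)] and
    the preimage of the colon ideal [(I : c)] are [A]-prime
    ([base_prime_colon]), the first is contained in the second, and they
    contract to the same prime of [A]. So they are equal, which says that
    [v b * c] in [I] forces [v b] in [I]: the ideal [I] is [B]-prime, hence
    prime since [v] is a PSI-morphism. *)

Section Ideals.
Variable R : comPzRingType.
Implicit Type I : set R.

Lemma idealMr I (x a : R) : is_ideal I -> I x -> I (x * a).
Proof. by case=> _ _ IM Ix; rewrite mulrC; apply: IM. Qed.

Lemma is_proper_idealE I : is_proper_ideal I <-> is_ideal I /\ ~ I 1.
Proof.
split=> -[iI In1]; split=> // I1; apply: In1; last by rewrite I1.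
by apply/seteqP; split=> // x _; rewrite -[x]mul1r; apply: idealMr.
Qed.

Definition adjoin (P : set R) (d : R) : set R :=
  [set x | exists2 y, P y & exists z, x = y + d * z].

Lemma adjoin_ideal (P : set R) d : is_ideal P -> is_ideal (adjoin P d).
Proof.
case=> P0 PD PM; split.
- by exists 0 => //; exists 0; rewrite mulr0 addr0.
- move=> _ _ [y Py [z ->]] [y' Py' [z' ->]].
  by exists (y + y'); [apply: PD | exists (z + z'); rewrite mulrDr addrACA].
- move=> a _ [y Py [z ->]].
  by exists (a * y); [apply: PM | exists (a * z); rewrite mulrDr mulrCA].
Qed.

End Ideals.

Section BasePrime.
Variables (A B : comPzRingType) (u : {rmorphism A -> B}).

Lemma base_prime_not1 (P : set B) : base_prime_ideal u P -> ~ P 1.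
Proof. by case=> /is_proper_idealE[]. Qed.

(** The [A]-prime ideals are the ideals saturated with respect to the scalars
    outside them, so saturating an ideal [D] with respect to the scalars outside
    an [A]-prime [P] is how to produce new ones. *)
Definition saturation (P D : set B) : set B :=
  [set x | exists2 a, ~ P (u a) & D (u a * x)].

Lemma sub_saturation (P D : set B) : base_prime_ideal u P ->
  D `<=` saturation P D.
Proof.
move=> /base_prime_not1 P1 x Dx.
by exists 1; rewrite rmorph1 // mul1r.
Qed.

Lemma base_prime_saturation (P D : set B) : base_prime_ideal u P ->
    is_ideal D -> P `<=` D -> (forall a, D (u a) -> P (u a)) ->
  base_prime_ideal u (saturation P D).
Proof.
move=> pP [D0 DD DM] PD DP.
have PuM a a' : ~ P (u a) -> ~ P (u a') -> ~ P (u (a * a')).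
  by move=> Pa Pa'; rewrite rmorphM => /(pP.2 a (u a')) [].
split.
  apply/is_proper_idealE; split; last by case=> a Pa; rewrite mulr1 => /DP.
  split; first exact: sub_saturation.
  - move=> x y [a Pa Dx] [a' Pa' Dy]; exists (a * a'); first exact: PuM.
    rewrite rmorphM mulrDr; apply: DD; last by rewrite -mulrA; apply: DM.
    by rewrite mulrAC mulrC; apply: DM.
  - by move=> b x [a Pa Dx]; exists a => //; rewrite mulrCA; apply: DM.
move=> a b [a' Pa' Dab]; have [Pa|Pa] := pselect (P (u a)).
  by left; apply/sub_saturation/PD.
by right; exists (a' * a); [apply: PuM | rewrite rmorphM -mulrA].
Qed.

(** The fibres of a PSI-morphism are fields or zero. Concretely, for [b] in [J]
    the saturation of [P + (b^2)] is [A]-prime, hence prime, hence contains [b]: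
    some [u a * b] with [u a] outside [P] is [b^2 * z] modulo [P]. If [b] were
    outside the prime [P], cancelling it would put [u a] in [J]. *)
Lemma base_prime_incomparable (P J : set B) : PSI_morphism u ->
    base_prime_ideal u P -> is_ideal J -> P `<=` J ->
    (forall a, J (u a) -> P (u a)) ->
  J `<=` P.
Proof.
move=> psi_u pP iJ PJ JP b Jb; have [_ JD _] := iJ.
have iP : is_ideal P by case: pP => -[].
have [P0 _ _] := iP.
pose D := adjoin P (b * b).
have iD : is_ideal D by apply: adjoin_ideal.
have PD : P `<=` D by move=> y Py; exists y => //; exists 0; rewrite mulr0 addr0.
have DP a : D (u a) -> P (u a).
  case=> y Py [z uaE]; apply: JP; rewrite uaE; apply: JD; first exact: PJ.
  by rewrite -mulrA; apply: idealMr.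
have [_ primeS] := psi_u _ (base_prime_saturation pP iD PD DP).
have Sbb : saturation P D (b * b).
  by apply: sub_saturation => //; exists 0 => //; exists 1; rewrite mulr1 add0r.
have {primeS Sbb} [a Pa [y Py [z ubE]]] : saturation P D b.
  by have [] := primeS _ _ Sbb.
have Pmul : P (b * (u a - b * z)).
  by rewrite mulrBr mulrA [b * u a]mulrC ubE addrK.
have [//|Pdiff] := (psi_u _ pP).2 _ _ Pmul.
case: Pa; apply: JP; rewrite -[u a](subrK (b * z)).
by apply: JD; [apply: PJ | apply: idealMr].
Qed.

End BasePrime.

Section Composition.
Variables (A B C : comPzRingType).
Variables (u : {rmorphism A -> B}) (v : {rmorphism B -> C}).

Lemma base_prime_colon (I : set C) (c : C) :
    base_prime_ideal (v \o u) I -> ~ I c ->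
  base_prime_ideal u [set b | I (v b * c)].
Proof.
case=> -[iI _] pI Ic; have [I0 ID IM] := iI; split=> /=.
  apply/is_proper_idealE; split=> /=; last by rewrite rmorph1 mul1r.
  split=> /=; first by rewrite rmorph0 mul0r.
  - by move=> x y Ix Iy; rewrite rmorphD mulrDl; apply: ID.
  - by move=> a x Ix; rewrite rmorphM -mulrA; apply: IM.
move=> a b; rewrite rmorphM -mulrA => /(pI a) [Ia|]; last by right.
by left; apply: idealMr.
Qed.

Lemma base_prime_comp (I : set C) : PSI_morphism u ->
  base_prime_ideal (v \o u) I -> base_prime_ideal v I.
Proof.
move=> psi_u pI; have [[iI In1] pIu] := pI; split=> // b c Ibc.
have [Ic|Ic] := pselect (I c); first by right.
left; have I1 := base_prime_not1 pI.
have [[iJ _] _] := base_prime_colon pI Ic.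
(* [v^-1(I)] is treated as the preimage of the colon ideal [(I : 1)]. *)
suff : [set b | I (v b * 1)] b by rewrite /= mulr1.
apply: (base_prime_incomparable psi_u (base_prime_colon pI I1) iJ) => // x /=.
  by rewrite mulr1 => Ix; apply: idealMr.
by rewrite mulr1 => /(pIu x) [].
Qed.

End Composition.

Theorem theorem2p10 (A B C : comPzRingType)
    (u : {rmorphism A -> B}) (v : {rmorphism B -> C}) :
  (PSI_morphism u -> PSI_morphism v -> PSI_morphism (v \o u)) /\
  (PSI_morphism (v \o u) -> PSI_morphism v).
Proof.
split=> [psi_u psi_v I pI|psi_vu I [propI pI]].
  exact/psi_v/(base_prime_comp psi_u pI).
by apply: psi_vu; split=> // a; apply: pI.
Qed.
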